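(* Let $X$ be a separable (real or complex) rearrangement invariant space on $\mathbb{N}$. If $X$ is lush, then $X$ is $c_0$ or $\ell_1$ (with its usual norm).
   Context: $\mathbb{N}$ carries counting measure. A Köthe function space on $\mathbb{N}$ is a real or complex Banach space $X$ of scalar sequences such that: (i) if $|f|\le|g|$ pointwise and $g\in X$, then $f\in X$ and $\|f\|\le\|g\|$; (ii) $\boldsymbol{1}_A\in X$ for every finite $A\subset\mathbb{N}$. $X'\subset X^*$ denotes the space of integrals, i.e. functionals $f\mapsto\sum_n f(n)g(n)$ with $g$ a sequence such that $gf\in\ell_1$ for all $f\in X$ (identified with $g$), with the norm of $X^*$; it is again a Köthe function space, and $X''=(X')'$. A Köthe function space $X$ on $\mathbb{N}$ is rearrangement invariant (r.i.) if: (1) for every bijection $\tau$ of $\mathbb{N}$ and integrable $f$, $f\in X$ iff $f\tau^{-1}\in X$, and then $\|f\|=\|f\tau^{-1}\|$; (2) $X'$ is a norming subspace of $X^*$ (so $X$ is isometrically a subspace of $X''$), and $X=X''$ or $X$ is the closed linear span of the simple integrable functions of $X''$; (3) $\ell_1\subset X\subset\ell_\infty$ with $\|f\|_X\le\|f\|_1$ for $f\in\ell_1$ and $\|f\|_\infty\le\|f\|_X$ for $f\in X$. A Banach space $X$ is lush if for all $x,y\in S_X$ and $\varepsilon>0$ there is $x^*\in S_{X^*}$ such that $x\in S:=\{z\in B_X:\operatorname{Re}x^*(z)>1-\varepsilon\}$ and $\operatorname{dist}(y,\overline{\mathrm{aconv}}(S))<\varepsilon$, where $\overline{\mathrm{aconv}}(S)$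 is the closed convex hull of $\{\theta z: |\theta|=1, z\in S\}$ ($\theta$ scalar), and $B_X,S_X$ are the closed unit ball and unit sphere. *)

(* Defs.v *)
From HB Require Import structures.
From mathcomp Require Import all_boot all_order all_algebra.
From mathcomp Require Import complex.
From mathcomp Require Import all_classical all_reals all_analysis.

Set Implicit Arguments.
Unset Strict Implicit.
Unset Printing Implicit Defensive.

Import Order.TTheory GRing.Theory Num.Theory.
Import numFieldNormedType.Exports.

Local Open Scope classical_set_scope.
Local Open Scope ring_scope.

Variant scalar_kind := RealScalars | ComplexScalars.

Definition scalar_field (R : realType) (k : scalar_kind) : numFieldType :=
  match k with RealScalars => R | ComplexScalars => R[i] end.

Definition re (R : realType) (k : scalar_kind) : scalar_field R k -> R :=
  match k return scalar_field R k -> R with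
  | RealScalars => id
  | ComplexScalars => @complex.Re R
  end.

Section Banach.
Variables (R : realType) (k : scalar_kind).
Local Notation K := (scalar_field R k).

(* In MathComp the norm of a K-normed space takes values in K (it is a real
   element of R[i] in the complex case); rnorm is the same number, in R. *)
Definition rnorm (V : normedModType K) (v : V) : R := re `|v|.

(* sup over B of |phi|. Suprema in R are 0 on unbounded sets; all uses below
   are for bounded functionals. *)
Definition supnorm (T : Type) (B : set T) (phi : T -> K^o) : R :=
  sup [set rnorm (phi x) | x in B].

Definition unit_ball (V : normedModType K) : set V := [set x | rnorm x <= 1].

Definition unit_sphere (V : normedModType K) : set V := [set x | rnorm x = 1].

Definition opnorm (V : normedModType K) (phi : V -> K^o) : R :=
  supnorm (@unit_ball V) phi.

Definition dual_sphere (V : normedModType K) : set {linear V -> K^o} :=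
  [set phi | continuous phi /\ opnorm phi = 1].

Definition slice (V : normedModType K) (phi : V -> K^o) (eps : R) : set V :=
  [set z | unit_ball z /\ 1 - eps < re (phi z)].

Definition closed_aconv (V : normedModType K) (S : set V) : set V :=
  smallest [set A | closed A /\ convex_set A]
    [set theta *: z | theta in [set t : K | `|t| = 1] & z in S].

Definition dist_to (V : normedModType K) (y : V) (A : set V) : R :=
  inf [set rnorm (y - a) | a in A].

Definition lush (V : normedModType K) : Prop :=
  forall x y : V, unit_sphere x -> unit_sphere y ->
  forall eps : R, 0 < eps ->
  exists phi : {linear V -> K^o},
    [/\ dual_sphere phi, slice phi eps x &
        dist_to y (closed_aconv (slice phi eps)) < eps].

Definition separable_space (V : normedModType K) : Prop :=
  exists2 D : set V, countable D & dense D.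

End Banach.

Section SequenceSpaces.
Variables (R : realType) (k : scalar_kind).
Local Notation K := (scalar_field R k).
Local Notation sequences := (nat -> K^o).

Definition ell1 : set sequences :=
  [set f | cvgn (series (fun n => rnorm (f n)))].
Definition ell1_norm (f : sequences) : R :=
  limn (series (fun n => rnorm (f n))).

Definition ellinf : set sequences :=
  [set f | has_ubound (range (fun n => rnorm (f n)))].
Definition ellinf_norm (f : sequences) : R :=
  sup (range (fun n => rnorm (f n))).

Definition c0 : set sequences := [set f | f @ \oo --> (0 : K^o)].

Definition seq_mul (f g : sequences) : sequences := fun n => f n * g n.

Definition pairing (f g : sequences) : K^o := limn (series (seq_mul f g)).

(* Integrability for counting measure is membership in ell1. *)
Definition simple_integrable (f : sequences) : Prop :=
  finite_set (range f) /\ ell1 f.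

End SequenceSpaces.

(* A Banach space of scalar sequences is given as an abstract Banach space X
   with an injective linear map j into the space of all sequences; the
   sequence f "belongs to X" when f is in the range of j. *)
Section Koethe.
Variables (R : realType) (k : scalar_kind).
Local Notation K := (scalar_field R k).
Local Notation sequences := (nat -> K^o).
Variables (X : completeNormedModType K) (j : {linear X -> sequences}).

Record koethe : Prop := Koethe {
  koethe_inj : injective j;
  koethe_ideal : forall (f : sequences) (x : X),
    (forall n, `|f n| <= `|j x n|) -> exists2 y : X, j y = f & `|y| <= `|x|;
  koethe_indic : forall A : set nat, finite_set A -> range j (\1_A : sequences)
}.

Definition assoc : set sequences :=
  [set g | forall x : X, ell1 (seq_mul g (j x))].
Definition assoc_norm (g : sequences) : R :=
  opnorm (fun x : X => pairing (j x) g).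
Definition assoc_ball : set sequences :=
  [set g | assoc g /\ assoc_norm g <= 1].

Definition biassoc : set sequences :=
  [set h | forall g, assoc g -> ell1 (seq_mul h g)].
Definition biassoc_norm (h : sequences) : R :=
  supnorm assoc_ball (fun g => pairing g h).

Definition assoc_norming : Prop :=
  forall x : X, rnorm x = supnorm assoc_ball (fun g => pairing (j x) g).

Definition biassoc_simple_span : set sequences :=
  [set s | exists (m : nat) (a : 'I_m -> K) (u : 'I_m -> sequences),
     (forall i, simple_integrable (u i) /\ biassoc (u i)) /\
     s = \sum_(i < m) a i *: u i].

Definition biassoc_simple_closure : set sequences :=
  [set h | biassoc h /\ forall eps : R, 0 < eps ->
     exists2 s, biassoc_simple_span s & biassoc_norm (h - s) < eps].

Record rearrangement_invariant : Prop := RearrangementInvariant {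
  ri_koethe : koethe;
  ri_rearrange : forall tau tau' : nat -> nat,
    cancel tau tau' -> cancel tau' tau ->
    forall f : sequences, ell1 f ->
    (range j f <-> range j (f \o tau')) /\
    (forall x y : X, j x = f -> j y = f \o tau' -> rnorm x = rnorm y);
  ri_norming : assoc_norming;
  ri_biassoc : range j = biassoc \/ range j = biassoc_simple_closure;
  ri_ell1 : forall f : sequences, ell1 f ->
    exists2 x : X, j x = f & rnorm x <= ell1_norm f;
  ri_ellinf : forall x : X,
    ellinf (j x) /\ ellinf_norm (j x) <= rnorm x
}.

Definition is_seq_space (E : set sequences) (N : sequences -> R) : Prop :=
  range j = E /\ forall x : X, rnorm x = N (j x).

End Koethe.

(* Main.v *)
Require Import Defs.
From mathcomp Require Import all_boot all_order all_algebra.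
From mathcomp Require Import complex.
From mathcomp Require Import all_classical all_reals all_analysis.
From mathcomp Require Import ring lra.
Set Implicit Arguments.
Unset Strict Implicit.
Unset Printing Implicit Defensive.
Import Order.TTheory GRing.Theory Num.Theory.
Import numFieldNormedType.Exports.
Local Open Scope classical_set_scope.
Local Open Scope ring_scope.

(** Write [e_i] for the unit vectors and [ones n] for [e_0 + ... + e_(n-1)].
The numbers [‖ones n‖] (the fundamental function of [X]) decide everything:
the space is [c0] when they are all at most 1, and [ell1] when [‖ones n‖ = n].

Lushness is used through [lush_test]: given nonzero [x] and [y], some
functional [phi] of norm at most 1 almost norms [x], and [|h y| / ‖y‖] is
bounded, for every linear [h], by the supremum of [|h|] over the slice that
[phi] cuts from the unit ball, up to a small error.  A well-chosen [h] then
restricts [phi].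

- [lush_increment]: take [y = e_m] and
  [h z = c phi(z_m e_m) - phi(z - z_m e_m)] with [c] large.  On the slice the
  two parts of [phi z] are almost positive and almost add up to 1 (because the
  norm depends on the moduli of the coordinates alone), and the bound on [h]
  forces [|phi e_m|] to be almost 0 or almost 1.  So if adding [e_m] to a
  vector [v] with [v_m = 0] increases the norm at all, then it is norming to
  let [phi e_m] be almost 1, and adding [e_m] once more increases the norm by
  a full unit.

- [ones_jump]: if [‖ones n‖ < ‖ones n.+1‖], then the previous item, applied to
  the coordinates one after the other, gives
  [‖2 ones n.+1‖ >= ‖ones n.+1‖ + n + 1], that is, [‖ones n.+1‖ = n + 1].
  Hence [‖ones n‖ = min n m] for a fixed [m] in [1, 2, ..., oo]
  ([ones_dichotomy]).

- [no_intermediate]: a finite [m >= 2] is impossible.  The model is the norm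
  which sums the [m] largest moduli; lushness fails for [x = ones m] and
  [y = (-1, 1, ..., 1)] with [m + 1] entries, since a vector [z] of the face
  [sum_(i < m) z_i = 1] satisfies [|z_m| <= z_0] and [|z_m| <= 1 - z_0], while
  [h z = -z_0 + z_1 + ... + z_m] has modulus at most 1 there and
  [h y / ‖y‖ = 1 + 1/m].

Separability gives [truncate_cvg]: every [x] is the limit of its truncations.
Otherwise [x] would have infinitely many disjoint blocks of norm at least [d],
the subsets of which give too many far apart vectors in the ideal [X].
For [m = 1] the norm is then the supremum norm, and [X] is the closure of the
finitely supported sequences; for [m = oo] the triangle inequality applied to
[ones n = |z| + (ones n - |z|)] shows that the norm dominates the [ell1] norm. *)

(** * Real and complex scalars *)

Section Scalars.
Variables (R : realType) (k : scalar_kind).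
Local Notation K := (scalar_field R k).
Local Notation abs z := (rnorm (z : K^o)).

Lemma reD (x y : K) : re (x + y) = re x + re y.
Proof. by move: x y; case: k => //= -[a b] [c d]. Qed.

Lemma reN (x : K) : re (- x) = - re x.
Proof. by move: x; case: k => //= -[a b]. Qed.

Lemma re0 : re (0 : K) = 0.
Proof. by case: k. Qed.

Lemma re1 : re (1 : K) = 1.
Proof. by case: k. Qed.

Lemma re_nat n : re (n%:R : K) = n%:R.
Proof. by elim: n => [|n IH]; rewrite ?re0 // -natr1 reD re1 IH natr1. Qed.

(** Norms have values in the scalar field; the next lemmas carry the relations
between them over to the real numbers. *)
Lemma re_normM (x z : K) : re (`|x| * z) = re `|x| * re z.
Proof.
move: x z; case: k => [//|] x [c d]; rewrite /re.
by rewrite normc_def /= mul0r subr0.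
Qed.

Lemma re_le (x y : K) : 0 <= x -> 0 <= y -> (re x <= re y) = (x <= y).
Proof.
move: x y; case: k => /= [//|] [a b] [c d].
rewrite !lecE /= => /andP[/eqP e1 _] /andP[/eqP e2 _].
by rewrite e1 e2 eqxx.
Qed.

Lemma re_lt (x y : K) : 0 <= x -> 0 <= y -> (re x < re y) = (x < y).
Proof. by move=> x0 y0; rewrite ltNge re_le // -real_ltNge ?ger0_real. Qed.

Lemma re_le_abs (z : K) : re z <= abs z.
Proof.
rewrite /rnorm; move: z; case: k => /= [z|z]; first exact: ler_norm.
have := normc_ge_Re z; rewrite lecE => /andP[_]; apply: le_trans.
by rewrite /= ler_norm.
Qed.

(** The inner product of [u] and [w], written with moduli only, so that the
real and the complex case have the same statement. *)
Lemma abs_sqrB (u w : K) n :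
  abs (u *+ n - w) ^+ 2 = n%:R ^+ 2 * abs u ^+ 2 + abs w ^+ 2
     - n%:R * (abs (u + w) ^+ 2 - abs u ^+ 2 - abs w ^+ 2).
Proof.
rewrite /rnorm; move: u w; case: k => /= [u w|u w].
  by rewrite !real_normK ?num_real // -(mulr_natl u); move: (n%:R) => m; ring.
have sq (z : R[i]) : complex.Re `|z| ^+ 2 = complex.Re z ^+ 2 + complex.Im z ^+ 2.
  by rewrite normc_def /= sqr_sqrtr // addr_ge0 ?sqr_ge0.
have ReD (x y : R[i]) : complex.Re (x + y) = complex.Re x + complex.Re y.
  by case: x y => [a b] [c d].
have ImD (x y : R[i]) : complex.Im (x + y) = complex.Im x + complex.Im y.
  by case: x y => [a b] [c d].
have ReN (x : R[i]) : complex.Re (- x) = - complex.Re x by case: x.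
have ImN (x : R[i]) : complex.Im (- x) = - complex.Im x by case: x.
have ReM m : complex.Re (u *+ m) = complex.Re u *+ m.
  by elim: m => // m IH; rewrite !mulrS ReD IH.
have ImM m : complex.Im (u *+ m) = complex.Im u *+ m.
  by elim: m => // m IH; rewrite !mulrS ImD IH.
rewrite !sq !(ReD, ImD, ReN, ImN) ReM ImM.
move: (complex.Re u) (complex.Im u) (complex.Re w) (complex.Im w) => a b c d.
rewrite -(mulr_natl a) -(mulr_natl b); move: (n%:R) => m.
by ring.
Qed.

Variable V : normedModType K.
Implicit Types v w : V.

Lemma rnorm_le v w : (rnorm v <= rnorm w) = (`|v| <= `|w|).
Proof. by rewrite re_le. Qed.

Lemma rnorm_ge0 v : 0 <= rnorm v.
Proof. by rewrite -re0 re_le. Qed.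

Lemma rnorm0 : rnorm (0 : V) = 0.
Proof. by rewrite /rnorm normr0 re0. Qed.

Lemma rnorm_eq0 v : rnorm v = 0 -> v = 0.
Proof.
move=> v0; apply/eqP; rewrite -normr_le0 -(normr0 V) -rnorm_le v0 rnorm0 //.
Qed.

Lemma rnorm_gt0 v : v != 0 -> 0 < rnorm v.
Proof.
by move=> v0; rewrite lt_neqAle rnorm_ge0 andbT eq_sym; apply: contra v0 => /eqP/rnorm_eq0 ->.
Qed.

Lemma rnormD v w : rnorm (v + w) <= rnorm v + rnorm w.
Proof. by rewrite /rnorm -reD re_le ?addr_ge0 // ler_normD. Qed.

Lemma rnormN v : rnorm (- v) = rnorm v.
Proof. by rewrite /rnorm normrN. Qed.

Lemma rnormB v w : rnorm (v - w) <= rnorm v + rnorm w.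
Proof. by rewrite -(rnormN w) rnormD. Qed.

Lemma rnormZ (a : K) v : rnorm (a *: v) = abs a * rnorm v.
Proof. by rewrite /rnorm normrZ re_normM. Qed.

Lemma rnorm_sum (I : Type) (r : seq I) (P : pred I) (F : I -> V) :
  rnorm (\sum_(i <- r | P i) F i) <= \sum_(i <- r | P i) rnorm (F i).
Proof.
elim/big_ind2: _ => [|v a w b va wb|//]; first by rewrite rnorm0.
by rewrite (le_trans (rnormD _ _)) // lerD.
Qed.

End Scalars.

Section ScalarNorms.
Variables (R : realType) (k : scalar_kind).
Local Notation K := (scalar_field R k).
Local Notation abs z := (rnorm (z : K^o)).

Lemma absM (a b : K) : abs (a * b) = abs a * abs b.
Proof. exact: (@rnormZ _ _ K^o). Qed.

Lemma abs1 : abs (1 : K) = 1.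
Proof. by rewrite /rnorm normr1 re1. Qed.

Lemma abs_normr (V : normedModType K) (v : V) : abs `|v| = rnorm v.
Proof. by rewrite /rnorm normr_id. Qed.

Lemma re_scale_norm (V : normedModType K) (v : V) (z : K^o) :
  re (`|v| *: z) = rnorm v * re z.
Proof. by rewrite -[X in X *: _]normr_id [LHS]re_normM normr_id. Qed.

Lemma unimodular_rotation (z : K) : exists2 t : K, `|t| = 1 & t * z = `|z|.
Proof.
have [->|z0] := eqVneq z 0; first by exists 1; rewrite ?normr1 ?normr0 ?mulr0.
exists (`|z| / z); last by rewrite divfK.
by rewrite normrM normr_id normfV mulfV // normr_eq0.
Qed.

Lemma abs_unimodular (t : K) : `|t| = 1 -> abs t = 1.
Proof. by rewrite /rnorm => ->; rewrite re1. Qed.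

(** Equality in [|u + w| <= |u| + |w| <= 1] forces [u] and [w] to have the same
argument, and then [|n u - w|] is [|n |u| - |w||]; this is the stable form. *)
Lemma almost_aligned (u w : K) (eps : R) n : 0 <= eps ->
  abs u + abs w <= 1 -> 1 - eps <= abs (u + w) ->
  abs (u *+ n - w) ^+ 2 <= (n%:R * abs u - abs w) ^+ 2 + 2 * n%:R * eps.
Proof.
move=> eps0; rewrite abs_sqrB.
have := rnorm_ge0 (u : K^o); have := rnorm_ge0 (w : K^o).
have := rnorm_ge0 (u + w : K^o); have n0 : 0 <= n%:R :> R by [].
move: (abs u) (abs w) (abs (u + w)) => A B S S0 B0 A0 AB SE.
have AB2 : (A + B) ^+ 2 <= 1 by rewrite expr_le1 // addr_ge0.
have S2 : 1 - 2 * eps <= S ^+ 2 by nra.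
rewrite -subr_ge0; have : 0 <= n%:R * (S ^+ 2 - 1 + 2 * eps + (1 - (A + B) ^+ 2)).
  by rewrite mulr_ge0 // addr_ge0; lra.
by move: (n%:R) => c; nra.
Qed.

End ScalarNorms.

(** The test functionals below combine the parts [z_m phi(e_m)] and
[phi z - z_m phi(e_m)] of a value [phi z]; this is their linearity. *)
Lemma test_linear (F : comPzRingType) (a x y p q f : F) n :
  (a * x + y) * f *+ n - (a * p + q - (a * x + y) * f) =
  a * (x * f *+ n - (p - x * f)) + (y * f *+ n - (q - y * f)).
Proof.
rewrite -(mulr_natr ((a * x + y) * f)) -(mulr_natr (x * f)) -(mulr_natr (y * f)).
by move: (n%:R) => c; ring.
Qed.

(** The estimate at the end of [lush_increment], with [A = |phi(z_m e_m)|],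
[B = |phi(z - z_m e_m)|], [b = |phi e_m|] and [H = |h z|].  The difference
[c A - B] lies between [-1] and [c b - (1 - b - eps)]. *)
Lemma aligned_bound (R : realType) (A B H b c eps : R) :
  0 <= A -> A <= b -> 0 <= B -> A + B <= 1 -> 1 - eps <= A + B ->
  0 <= H -> 0 < eps -> 0 <= c -> 2 <= c * b ->
  H ^+ 2 <= (c * A - B) ^+ 2 + 2 * c * eps ->
  H <= c * b - 1 + b + eps + c * eps.
Proof.
move=> A0 Ab B0 AB1 AB2 H0 eps0 c0 cb HH.
set Q := c * b - 1 + b + eps.
have cA : c * A <= c * b by rewrite ler_wpM2l.
have cA0 : 0 <= c * A by rewrite mulr_ge0.
have Q1 : 1 <= Q by rewrite /Q; lra.
have ce : 0 <= c * eps by apply: mulr_ge0; lra.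
have DQ : 0 <= (Q - (c * A - B)) * (Q + (c * A - B)).
  by apply: mulr_ge0; rewrite /Q; lra.
have Qce : 0 <= (Q - 1) * (c * eps) by apply: mulr_ge0; lra.
have ce2 := sqr_ge0 (c * eps).
have : H ^+ 2 <= (Q + c * eps) ^+ 2 by nra.
by rewrite ler_sqr // nnegrE; lra.
Qed.

(** * Lushness and seminorms *)

Section Seminorms.
Variables (R : realType) (k : scalar_kind).
Local Notation K := (scalar_field R k).
Local Notation abs z := (rnorm (z : K^o)).

(** Neighbourhoods in a normed space over the scalar field have radii in that
field, hence this embedding of the positive real numbers. *)
Lemma real_scalar (e : R) : 0 < e -> exists2 e' : K, 0 < e' & re e' = e.
Proof.
by case: k => /= e0; [exists e | exists (e%:C)%C => //; rewrite ltcR].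
Qed.

Variable V : normedModType K.
Implicit Types v w : V.

Lemma rnorm_ball v w (e : R) (e' : K) : 0 < e' -> re e' = e ->
  ball v e' w <-> rnorm (v - w) < e.
Proof.
move=> e'0 e'e; rewrite -ball_normE /ball_ /=.
by rewrite -e'e /rnorm re_lt // ltW.
Qed.

Lemma nbhs_rnorm v (e : R) : 0 < e -> nbhs v [set w | rnorm (v - w) < e].
Proof.
move=> /real_scalar[e' e'0 e'e]; apply/nbhs_ballP; exists e' => //.
by move=> w /(rnorm_ball _ _ e'0 e'e).
Qed.

Variables (p : V -> R) (L : R).
Hypothesis p_triangle : forall v w, p (v + w) <= p v + p w.
Hypothesis p_scale : forall (a : K) v, p (a *: v) = abs a * p v.
Hypothesis p_bounded : forall v, p v <= L * rnorm v.

Let pB v w : p v <= p w + p (v - w).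
Proof. by rewrite -{1}(subrK w v) addrC p_triangle. Qed.

Lemma seminorm_ball_closed c : closed [set v | p v <= c].
Proof.
move=> v cv /=; apply/ler_addgt0Pr => e e0.
have L0 : 0 < `|L| + 1 by rewrite ltr_wpDl.
have /cv[w [/= pw vw]] := @nbhs_rnorm v (e / (`|L| + 1)) (divr_gt0 e0 L0).
rewrite (le_trans (pB v w)) // lerD // (le_trans (p_bounded _)) //.
apply: le_trans (_ : (`|L| + 1) * rnorm (v - w) <= _).
  by rewrite ler_wpM2r ?rnorm_ge0 // ler_wpDr // ler_norm.
by rewrite mulrC -ler_pdivlMr // ltW.
Qed.

Lemma seminorm_ball_convex c : convex_set [set v : V | p v <= c].
Proof.
move=> v w t; rewrite !inE /= => pv pw.
have [t0 t1] : 0 <= t%:num /\ 0 <= 1 - t%:num by rewrite subr_ge0; split.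
have e1 : abs (t%:num : K) + abs (1 - t%:num : K) = 1.
  by rewrite /rnorm -reD !ger0_norm // addrC subrK re1.
apply: le_trans (p_triangle _ _) _; rewrite !p_scale.
rewrite -[leRHS]mul1r -e1 mulrDl lerD // ler_wpM2l ?rnorm_ge0 //.
Qed.

(** The balls of a continuous seminorm are closed, convex and invariant under
multiplication by unimodular scalars. *)
Lemma seminorm_le_closed_aconv (S : set V) c :
  (forall z, S z -> p z <= c) -> forall z, closed_aconv S z -> p z <= c.
Proof.
move=> Sc; apply: smallest_sub => [|z [t /= t1 [w Sw <-]]].
  by split; [exact: seminorm_ball_closed | exact: seminorm_ball_convex].
by rewrite /= p_scale abs_unimodular // mul1r Sc.
Qed.

End Seminorms.

Section Lush.
Variables (R : realType) (k : scalar_kind).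
Local Notation K := (scalar_field R k).
Local Notation abs z := (rnorm (z : K^o)).
Variable V : normedModType K.

(** The supremum of an unbounded set is 0, so [opnorm phi = 1] entails that
[phi] is bounded on the ball. *)
Lemma opnorm1_le (phi : V -> K^o) v : opnorm phi = 1 -> rnorm v <= 1 ->
  abs (phi v) <= 1.
Proof.
move=> phi1 v1; rewrite -phi1 /opnorm /supnorm; apply: ub_le_sup.
  have [//|noub] := pselect (has_sup [set rnorm (phi x) | x in @unit_ball R k V]).
    by case.
  by move: phi1; rewrite /opnorm /supnorm sup_out // => /eqP; rewrite eq_sym oner_eq0.
by exists v.
Qed.

Lemma normalize (x : V) : x != 0 ->
  exists2 x1 : V, rnorm x1 = 1 & x = `|x| *: x1.
Proof.
move=> x0; exists (`|x|^-1 *: x); last by rewrite scalerA divff ?scale1r ?normr_eq0.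
by rewrite /rnorm normrZ normfV normr_id mulVf ?normr_eq0 // re1.
Qed.

(** Lushness in homogeneous form, for vectors that need not be normalized, and
with the distance to the absolutely convex hull replaced by its effect on
seminorms. *)
Lemma lush_functional (x y : V) (eps : R) : lush V -> x != 0 -> y != 0 -> 0 < eps ->
  exists phi : {linear V -> K^o},
    [/\ forall z, abs (phi z) <= rnorm z,
        (1 - eps) * rnorm x < re (phi x) &
        forall (p : V -> R) (c L : R),
          (forall v w, p (v + w) <= p v + p w) ->
          (forall (a : K) v, p (a *: v) = abs a * p v) ->
          (forall v, p v <= L * rnorm v) ->
          (forall z, rnorm z <= 1 -> 1 - eps < re (phi z) -> p z <= c) ->
          p y <= (c + L * eps) * rnorm y].
Proof.
move=> Vlush x0 y0 eps0.
have [x1 nx1 ex] := normalize x0; have [y1 ny1 ey] := normalize y0.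
have [phi [[_ phi1] [_ phix] phiy]] := Vlush x1 y1 nx1 ny1 eps eps0.
exists phi; split.
- move=> z; have [->|z0] := eqVneq z 0; first by rewrite linear0 !rnorm0.
  have [z1 nz1 {1}->] := normalize z0.
  rewrite linearZ rnormZ abs_normr ler_piMr ?rnorm_ge0 //.
  by rewrite opnorm1_le // nz1.
- rewrite {2}ex linearZ /= re_scale_norm mulrC ltr_pM2l // rnorm_gt0 //.
move=> p c L pD pZ pL pc.
have nonneg v : 0 <= p v.
  have : p 0 <= p v + p (- v) by rewrite -(subrr v) pD.
  rewrite -scaleN1r pZ -(scale0r 0) pZ rnorm0 mul0r.
  rewrite {1}/rnorm normrN1 re1 mul1r -mulr2n pmulrn_lge0 //.
rewrite ey pZ abs_normr mulrC rnormZ abs_normr ny1 mulr1.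
have L0 : 0 <= L.
  by have := le_trans (nonneg x1) (pL x1); rewrite nx1 mulr1.
rewrite ler_wpM2r ?rnorm_ge0 //.
have /inf_lt[|_ [a Sa <-] ya] := phiy.
  exists (rnorm (y1 - x1)); exists x1 => //; apply: sub_gen_smallest.
  by exists 1; rewrite /= ?normr1 //; exists x1; rewrite ?scale1r //; split => //; rewrite /unit_ball /= nx1.
have -> : y1 = a + (y1 - a) by rewrite addrC subrK.
apply: le_trans (pD _ _) _; rewrite lerD //.
  apply: (@seminorm_le_closed_aconv _ _ _ p L pD pZ pL _ c _ a Sa).
  by move=> z [z1 phiz]; exact: pc.
by rewrite (le_trans (pL _)) // ler_wpM2l // ltW.
Qed.

Corollary lush_test (x y : V) (eps : R) : lush V -> x != 0 -> y != 0 -> 0 < eps ->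
  exists phi : {linear V -> K^o},
    [/\ forall z, abs (phi z) <= rnorm z,
        (1 - eps) * rnorm x < re (phi x) &
        forall (h : V -> K) (c L : R),
          (forall a v w, h (a *: v + w) = a * h v + h w) ->
          (forall v, abs (h v) <= L * rnorm v) ->
          (forall z, rnorm z <= 1 -> 1 - eps < re (phi z) -> abs (h z) <= c) ->
          abs (h y) <= (c + L * eps) * rnorm y].
Proof.
move=> Vlush x0 y0 eps0.
have [phi [phi1 phix phiy]] := lush_functional Vlush x0 y0 eps0.
exists phi; split => // h c L h_lin hL hc.
have hD v w : h (v + w) = h v + h w by rewrite -[v]scale1r h_lin mul1r scale1r.
have h0 : h 0 = 0 by apply: (addrI (h 0)); rewrite -hD !addr0.
apply: (phiy (fun v => abs (h v)) c L _ _ hL hc) => [v w|a v].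
  by rewrite hD; exact: (@rnormD _ _ K^o).
by rewrite -[_ *: v]addr0 h_lin h0 addr0 absM.
Qed.

End Lush.

(** * Separable ideals of sequences *)

Section Kothe.
Variables (R : realType) (k : scalar_kind).
Local Notation K := (scalar_field R k).
Local Notation abs z := (rnorm (z : K^o)).

Lemma complete_rnorm (X : completeNormedModType K) (s : nat -> X) :
  (forall d : R, 0 < d -> exists N, forall n, (N <= n)%N -> rnorm (s n - s N) < d) ->
  exists y, forall d : R, 0 < d ->
    exists N, forall n, (N <= n)%N -> rnorm (y - s n) < d.
Proof.
move=> sC.
have [y sy] : exists y : X, s n @[n --> \oo] --> y.
  apply/cvg_ex.
  apply: cauchy_cvg; apply: cauchy_exP => e e0.
  have e0' : 0 < re e.
    by rewrite -(re0 _ k) re_lt // ltW.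
  have [N sN] := sC _ e0'; exists (s N); exists N => // n /= nN.
  by apply/(rnorm_ball _ _ e0 erefl); rewrite -rnormN opprB; exact: sN.
exists y => d d0; have [N _ sN] := sy _ (nbhs_rnorm y d0).
by exists N => n nN; exact: sN.
Qed.

Variables (X : completeNormedModType K) (j : {linear X -> (nat -> K^o)}).
Variable e : nat -> X.
Hypothesis j_inj : injective j.
Hypothesis j_ideal : forall (f : nat -> K^o) (x : X),
    (forall n, `|f n| <= `|j x n|) -> exists2 y : X, j y = f & `|y| <= `|x|.
Hypothesis j_basis : forall i n, j (e i) n = (n == i)%:R.
Hypothesis j_coord : forall x n, abs (j x n) <= rnorm x.

Lemma coordD x y n : j (x + y) n = j x n + j y n.
Proof. by rewrite linearD. Qed.
Lemma coordN x n : j (- x) n = - j x n.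
Proof. by rewrite linearN. Qed.
Lemma coordB x y n : j (x - y) n = j x n - j y n.
Proof. by rewrite coordD coordN. Qed.
Lemma coordZ a x n : j (a *: x) n = a * j x n.
Proof. by rewrite linearZ. Qed.
Lemma coord0 n : j 0 n = 0.
Proof. by rewrite linear0. Qed.

Lemma norm_monotone x y : (forall n, abs (j x n) <= abs (j y n)) -> rnorm x <= rnorm y.
Proof.
move=> xy; have [n|z /j_inj -> zx] := @j_ideal (j x) y.
  by rewrite -rnorm_le.
by rewrite rnorm_le.
Qed.

Definition truncate n x : X := \sum_(i < n) j x i *: e i.
Definition ones n : X := \sum_(i < n) e i.

Lemma coord_sum (a : nat -> K) n m :
  j (\sum_(i < n) a i *: e i) m = if (m < n)%N then a m else 0.
Proof.
elim: n => [|n IH]; first by rewrite big_ord0 coord0.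
rewrite big_ord_recr coordD IH coordZ j_basis /=.
have [->|mn] := eqVneq m n; first by rewrite ltnn ltnSn add0r mulr1.
by rewrite mulr0 addr0 ltnS [(m <= n)%N]leq_eqVlt (negbTE mn).
Qed.

Lemma coord_truncate n x m : j (truncate n x) m = if (m < n)%N then j x m else 0.
Proof. exact: (coord_sum (j x)). Qed.

Lemma coord_ones n m : j (ones n) m = (m < n)%:R.
Proof.
rewrite /ones; under eq_bigr do rewrite -[e _]scale1r.
by rewrite (coord_sum (fun=> 1)); case: ifP.
Qed.

Lemma truncateB n x y : truncate n (x - y) = truncate n x - truncate n y.
Proof.
rewrite /truncate -sumrB; apply: eq_bigr => i _.
by rewrite coordB scalerBl.
Qed.

Hypothesis X_sep : separable_space X.

Section Blocks.
Variable s : nat -> nat.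
Hypothesis s_mono : forall n, (s n <= s n.+1)%N.

Let block n x := truncate (s n.+1) x - truncate (s n) x.

Let coord_block n x m :
  j (block n x) m = if (s n <= m < s n.+1)%N then j x m else 0.
Proof.
rewrite coordB !coord_truncate; case: (leqP (s n) m) => smn /=; first by rewrite subr0.
by rewrite (leq_trans smn (s_mono n)) subrr.
Qed.

Let s_homo m n : (m <= n)%N -> (s m <= s n)%N.
Proof.
apply: (@homo_leq _ s leq leqnn) => // a b c; exact: leq_trans.
Qed.

Lemma block_uniq m n i : (s m <= i < s m.+1)%N -> (s n <= i < s n.+1)%N -> m = n.
Proof.
move=> /andP[m1 m2] /andP[n1 n2]; have [mn|nm|//] := ltngtP m n.
  by have := leq_trans (leq_trans m2 (s_homo mn)) n1; rewrite ltnn.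
by have := leq_trans (leq_trans n2 (s_homo nm)) m1; rewrite ltnn.
Qed.

(** A diagonal argument in the style of Cantor: with [z_n] enumerating a
countable dense set, keep the [n]-th block of [x] exactly when the [n]-th block
of [z_n] is small.  The resulting vector is at distance at least [d / 2] from
every [z_n]. *)
Lemma separable_blocks x (d : R) : 0 < d ->
  ~ (forall n, d <= rnorm (truncate (s n.+1) x - truncate (s n) x)).
Proof.
move=> d0 blocks; have [D /countable_injP[g g_inj] denseD] := X_sep.
have block_le n z : rnorm (block n z) <= rnorm z.
  by apply: norm_monotone => m; rewrite coord_block; case: ifP; rewrite ?rnorm0 ?rnorm_ge0.
(* the injection g serves as the enumeration, so block g z is paired with z *)
pose T n := exists z, [/\ D z, g z = n & rnorm (block n z) < d / 2].
pose f m : K^o := if `[< exists2 n, T n & (s n <= m < s n.+1)%N >] then j x m else 0.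
have [m|y jy _] := @j_ideal f x.
  by rewrite /f; case: ifP; rewrite ?normr0 ?normr_ge0.
have d20 : 0 < d / 2 by lra.
have [z [yz Dz]] : [set z | rnorm (y - z) < d / 2] `&` D !=set0.
  have := nbhs_rnorm y d20; rewrite nbhsE => -[U [oU Uy] sub].
  have [|z [Uz Dz]] := denseD U _ oU; first by exists y.
  by exists z; split => //; exact: sub.
have byz : rnorm (block (g z) y - block (g z) z) < d / 2.
  apply: le_lt_trans yz; rewrite -[in leRHS](subrK z y) addrK.
  have -> : block (g z) y - block (g z) z = block (g z) (y - z).
    by rewrite /block !truncateB; rewrite opprD addrACA !opprB opprK [- _ + _]addrC.
  exact: block_le.
have [Tn|nTn] := pselect (T (g z)).
  have bz : rnorm (block (g z) z) < d / 2.
    have [z' [Dz' gz' bz']] := Tn.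
    by rewrite -(g_inj z' z) ?inE // gz'.
  have byx : block (g z) y = block (g z) x.
    apply: j_inj; apply/funext => m; rewrite !coord_block; case: ifP => // mn.
    by rewrite jy /f; case: asboolP => // -[]; exists (g z).
  have := blocks (g z); rewrite byx in byz.
  by rewrite -/(block _ _); have := rnormD (block (g z) x - block (g z) z) (block (g z) z); rewrite subrK; lra.
have bz : ~ rnorm (block (g z) z) < d / 2 by move=> bz; apply: nTn; exists z.
apply: bz; apply: le_lt_trans byz; rewrite (_ : block (g z) y = 0) ?sub0r ?rnormN //.
apply: j_inj; apply/funext => m; rewrite coord_block coord0; case: ifP => // mn.
rewrite jy /f; case: asboolP => // -[n Tn mn'].
by case: nTn; rewrite (block_uniq mn mn').
Qed.

End Blocks.

(** If the truncations were not a Cauchy sequence, then consecutive blocks of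
norm at least [d] could be cut off from [x]; and if they are one, then their limit has
the same coordinates as [x]. *)
Lemma truncate_cvg x (d : R) : 0 < d ->
  exists N, forall n, (N <= n)%N -> rnorm (x - truncate n x) < d.
Proof.
have [y yP] : exists y, forall d : R, 0 < d ->
    exists N, forall n, (N <= n)%N -> rnorm (y - truncate n x) < d.
  apply: complete_rnorm => {}d d0; apply: contrapT => nC.
  have /choice[B BP] : forall n, exists b, (n <= b)%N /\ d <= rnorm (truncate b x - truncate n x).
    move=> n; apply: contrapT => nb; apply: nC; exists n => b nleb.
    by rewrite ltNge; apply/negP => db; apply: nb; exists b.
  apply: (@separable_blocks (fun n => iter n B 0) _ x d d0) => n.
    exact: (BP _).1.
  exact: (BP _).2.
suff xy : x = y by move: yP; rewrite -xy; apply.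
apply: j_inj; apply/funext => m; apply/eqP; rewrite -subr_eq0; apply/eqP.
apply: rnorm_eq0; apply/eqP; rewrite eq_le rnorm_ge0 andbT; apply/ler_addgt0Pr => c c0.
have [N yN] := yP c c0; have := yN (maxn N m.+1) (leq_maxl _ _).
have := j_coord (y - truncate (maxn N m.+1) x) m.
rewrite coordB coord_truncate leq_maxr -rnormN opprB add0r => h1 /ltW; exact: le_trans.
Qed.

(** * The effect of increasing one coordinate *)

(** Rotating the two values so that both become nonnegative. *)
Lemma functional_add_le (phi : {linear X -> K^o}) x y (C : R) :
  (forall z, abs (phi z) <= rnorm z) ->
  (forall t t' : K, `|t| = 1 -> `|t'| = 1 -> rnorm (t *: x + t' *: y) <= C) ->
  abs (phi x) + abs (phi y) <= C.
Proof.
move=> phi1 xyC.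
have [t t1 tx] := unimodular_rotation (phi x).
have [t' t'1 ty] := unimodular_rotation (phi y).
apply: le_trans (xyC t t' t1 t'1); apply: le_trans (phi1 _).
apply: le_trans (re_le_abs _); rewrite linearD !linearZ /=.
by rewrite [t *: _]tx [t' *: _]ty reD.
Qed.

Hypothesis e_norm : forall i, rnorm (e i) = 1.

Lemma coordZe x m a n : j (x - a *: e m) n = if n == m then j x n - a else j x n.
Proof.
by rewrite coordB coordZ j_basis; case: eqVneq; rewrite ?mulr1 // mulr0 subr0.
Qed.

(** Rotating one coordinate against the others does not change the norm. *)
Lemma split_coord (phi : {linear X -> K^o}) z m :
  (forall z, abs (phi z) <= rnorm z) ->
  abs (j z m * phi (e m)) + abs (phi z - j z m * phi (e m)) <= rnorm z.
Proof.
move=> phi1.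
have -> : j z m * phi (e m) = phi (j z m *: e m) by rewrite linearZ.
rewrite -linearB; apply: functional_add_le => // t t' t1 t'1.
apply: norm_monotone => n.
rewrite coordD !coordZ coordZe j_basis.
case: eqVneq => [->|nm]; first by rewrite subrr !mulr0 mulr1 addr0 absM abs_unimodular ?mul1r.
by rewrite !mulr0 add0r absM abs_unimodular ?mul1r.
Qed.

Hypothesis X_lush : lush X.

(** An increase of the norm at the first step means that [|phi e_m|] is bounded
away from 0 for every [phi] that almost norms [v + e_m]; the test functional
then shows that [|phi e_m|] is almost 1, and [phi] bounds [‖v + 2 e_m‖] below. *)
Lemma lush_increment v m : j v m = 0 -> rnorm v < rnorm (v + e m) ->
  rnorm (v + e m) + 1 <= rnorm (v + e m + e m).
Proof.
move=> vm0 act; rewrite leNgt; apply/negP => lt.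
set N := rnorm (v + e m) in act lt; set N2 := rnorm (v + e m + e m) in lt.
pose mu := Num.min (N - rnorm v) (N + 1 - N2).
have mu0 : 0 < mu by rewrite lt_min; apply/andP; split; lra.
have mu1 : mu <= N - rnorm v by rewrite ge_min lexx.
have mu2 : mu <= N + 1 - N2 by rewrite ge_min lexx orbT.
have v0 := rnorm_ge0 v.
(* c b exceeds 2 as soon as b is at least mu / 2, whatever eps is *)
have [c cmu] : exists c : nat, 4 < c%:R * mu.
  exists (Num.bound (4 / mu)); rewrite -ltr_pdivrMr //.
  by apply: archi_boundP; rewrite divr_ge0 // ltW.
have c0 : 0 <= c%:R :> R by [].
pose eps := mu / (2 * (N + 2 * c%:R + 3)).
have den0 : 0 < N + 2 * c%:R + 3 by lra.
have eps0 : 0 < eps by rewrite divr_gt0 // mulr_gt0.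
have epsE : eps * N + eps * (2 * c%:R) + 3 * eps = mu / 2.
  by rewrite /eps; field; apply: lt0r_neq0.
have epsN : 0 <= eps * N by apply: mulr_ge0; lra.
have epsc : 0 <= eps * (2 * c%:R) by apply: mulr_ge0; lra.
have x_neq0 : v + e m != 0.
  by apply: contraTneq act => x0; rewrite /N x0 rnorm0 -leNgt.
have em_neq0 : e m != 0.
  by apply/eqP => em0; have := e_norm m; rewrite em0 rnorm0; lra.
have [phi [phi1 phix phiy]] := lush_test X_lush x_neq0 em_neq0 eps0.
set f := phi (e m); set b := abs f.
have b1 : b <= 1 by rewrite -(e_norm m); exact: phi1.
have b0 : 0 <= b := rnorm_ge0 _.
rewrite -/N linearD /= reD -/f in phix.
have phiv : re (phi v) <= rnorm v := le_trans (re_le_abs _) (phi1 v).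
have ref : re f <= b := re_le_abs _.
have b_lower : mu / 2 <= b by nra.
(* were b closer to 1, phi would show that N2 is larger than assumed *)
have b_upper : b <= 1 - mu / 2.
  have [t t1 tf] := unimodular_rotation f.
  have phiE : phi (v + t *: e m + t *: e m) = phi v + `|f| + `|f|.
    by rewrite !linearD !linearZ /= -/f [t *: f]tf.
  have N2E : rnorm (v + t *: e m + t *: e m) = N2.
    have tt : abs (t + t) = abs (1 + 1 : K).
      have -> : t + t = t * (1 + 1) by rewrite mulrDr mulr1.
      by rewrite absM abs_unimodular // mul1r.
    have coords n : abs (j (v + t *: e m + t *: e m) n) = abs (j (v + e m + e m) n).
      rewrite !coordD !coordZ !j_basis; case: eqVneq => [->|_].
        by rewrite !mulr1 vm0 !add0r.
      by rewrite mulr0.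
    by apply/eqP; rewrite eq_le; apply/andP; split; apply: norm_monotone => n;
      rewrite coords.
  have := le_trans (re_le_abs _) (phi1 (v + t *: e m + t *: e m)).
  rewrite N2E phiE !reD -/(rnorm (f : K^o)) -/b.
  by lra.
pose h z := j z m * f *+ c - (phi z - j z m * f).
have := phiy h (c%:R * b - 1 + b + eps + c%:R * eps) (c%:R + 1).
have -> : abs (h (e m)) = c%:R * b.
  rewrite /h j_basis eqxx mul1r subrr subr0 -mulr_natl absM.
  by rewrite /rnorm normr_nat re_nat.
rewrite e_norm mulr1 => hphi.
have cb : 2 <= c%:R * b by nra.
suff : c%:R * b <= c%:R * b - 1 + b + eps + c%:R * eps + (c%:R + 1) * eps by nra.
apply: hphi => [a x y|z|z z1 phiz].
- have phi_lin : phi (a *: x + y) = a * phi x + phi y by rewrite linearP.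
  rewrite /h coordD coordZ phi_lin; exact: (@test_linear K a (j x m) (j y m) (phi x) (phi y) f c).
- apply: le_trans (rnormB _ _) _; rewrite -mulr_natl absM.
  have -> : abs (c%:R : K) = c%:R by rewrite /rnorm normr_nat re_nat.
  have := split_coord z m phi1; rewrite -/f.
  have := rnorm_ge0 (j z m * f : K^o); have := rnorm_ge0 (phi z - j z m * f : K^o).
  by move: (abs _) (abs _) (rnorm z) => A B Z; nra.
set u := j z m * f; set w := phi z - u.
have ub : abs u <= b.
  by rewrite absM ler_piMl // (le_trans (j_coord _ _)).
have uw : abs u + abs w <= 1 by apply: le_trans z1; exact: split_coord.
have uw1 : 1 - eps <= abs (u + w).
  by rewrite /w [u + _]addrC subrK (le_trans (ltW phiz)) // re_le_abs.
have := almost_aligned c (ltW eps0) uw uw1; rewrite -/u -/w.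
have uw2 := le_trans uw1 (@rnormD _ _ K^o u w).
have u0 := rnorm_ge0 (u : K^o); have w0 := rnorm_ge0 (w : K^o).
have h0 := rnorm_ge0 (h z : K^o); rewrite /h -/u -/w in h0 *.
by apply: aligned_bound => //; lra.
Qed.

(** * The fundamental function *)

Lemma onesS n : ones n.+1 = ones n + e n.
Proof. by rewrite /ones big_ord_recr. Qed.

Lemma ones0 : ones 0 = 0.
Proof. by rewrite /ones big_ord0. Qed.

Lemma ones_le n m : (n <= m)%N -> rnorm (ones n) <= rnorm (ones m).
Proof.
move=> nm; apply: norm_monotone => i; rewrite !coord_ones.
case: ltnP => // [im|_]; first by rewrite (leq_trans im nm).
by rewrite rnorm0 rnorm_ge0.
Qed.

Lemma onesS_le n : rnorm (ones n.+1) <= rnorm (ones n) + 1.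
Proof. by rewrite onesS -(e_norm n) rnormD. Qed.

Lemma ones_le_n n : rnorm (ones n) <= n%:R.
Proof.
elim: n => [|n IH]; first by rewrite ones0 rnorm0.
by rewrite (le_trans (onesS_le n)) // -natr1 lerD2r.
Qed.

Hypothesis ones_drop : forall i n, (i <= n)%N ->
  rnorm (ones n.+1 - e i) = rnorm (ones n).

(** Doubling the coordinates of [ones n.+1] one after the other: coordinate [i]
is relevant each time, because without it only the norm [‖ones n‖ + i] is
available.  In the end the norm has doubled and also grown by [n.+1]. *)
Lemma ones_jump n : rnorm (ones n) < rnorm (ones n.+1) ->
  rnorm (ones n.+1) = n.+1%:R.
Proof.
move=> jump; apply/eqP; rewrite eq_le ones_le_n /=.
suff raise i : (i <= n.+1)%N ->
    rnorm (ones n.+1) + i%:R <= rnorm (ones n.+1 + ones i).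
  have := raise n.+1 (leqnn _); have := rnormD (ones n.+1) (ones n.+1).
  by lra.
elim: i => [|i IH] iln; first by rewrite ones0 !addr0.
have {}IH := IH (ltnW iln).
set x := ones n.+1 + ones i in IH.
have xi : j (x - e i) i = 0.
  by rewrite coordB coordD !coord_ones j_basis iln ltnn eqxx addr0 subrr.
have drop : rnorm (x - e i) <= rnorm (ones n) + i%:R.
  rewrite /x addrAC (le_trans (rnormD _ _)) // ones_drop // lerD2l.
  exact: ones_le_n.
have := lush_increment xi; rewrite subrK (onesS i) addrA -/x -natr1.
have gap : rnorm (x - e i) < rnorm x by lra.
by move=> /(_ gap); lra.
Qed.

(** After the first index [m] at which the norms stall, a later jump to
[‖ones n.+1‖ = n.+1] is excluded by [‖ones n.+1‖ <= ‖ones n‖ + 1 = m + 1]. *)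
Lemma ones_dichotomy :
  (forall n, rnorm (ones n) = n%:R) \/
  exists m, [/\ (0 < m)%N, rnorm (ones m) = m%:R & forall n, rnorm (ones n) <= m%:R].
Proof.
have [inc|/existsNP stall] := pselect (forall n, rnorm (ones n) < rnorm (ones n.+1)).
  left => -[|n]; first by rewrite ones0 rnorm0.
  exact: ones_jump.
right; have {}stall : exists n, rnorm (ones n.+1) <= rnorm (ones n).
  by have [n /negP] := stall; rewrite -leNgt; exists n.
have [m stall_m min_m] := ex_minnP stall.
have ones_m : rnorm (ones m) = m%:R.
  case: m stall_m min_m => [|m] _ min_m; first by rewrite ones0 rnorm0.
  apply: ones_jump; rewrite ltNge; apply/negP => /min_m.
  by rewrite ltnn.
exists m; split => //.
  rewrite lt0n; apply: contraTneq stall_m => ->.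
  by rewrite onesS ones0 add0r e_norm rnorm0 ler10.
suff above d : rnorm (ones (m + d)) <= m%:R.
  by move=> n; rewrite (le_trans (ones_le (leq_addl m n))).
elim: d => [|d IH]; first by rewrite addn0 ones_m.
rewrite addnS; have [jump|] := ltP (rnorm (ones (m + d))) (rnorm (ones (m + d).+1)).
  have := onesS_le (m + d); rewrite ones_jump //.
  case: d IH jump => [|d] IH jump; first by move: jump; rewrite addn0 ltNge stall_m.
  rewrite -natr1 lerD2r => /le_trans /(_ IH); rewrite ler_nat addnS.
  by rewrite ltnNge leq_addr.
by move=> /le_trans; apply.
Qed.

(** Approximation by truncations passes the bound from finite supports to all
of [X]. *)
Lemma norm_le_sup (M C : R) x : (forall n, rnorm (ones n) <= M) -> 0 < C ->
  (forall i, abs (j x i) <= C) -> rnorm x <= M * C.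
Proof.
move=> onesM C0 xC; apply/ler_addgt0Pr => d d0.
have [N /(_ N (leqnn N)) xN] := truncate_cvg x d0.
have [c c0 cC] := real_scalar k C0.
have absc : abs c = C by rewrite /rnorm ger0_norm ?ltW.
rewrite -[x](subrK (truncate N x)) addrC (le_trans (rnormD _ _)) // lerD //; last exact: ltW.
apply: le_trans (_ : rnorm (c *: ones N) <= _).
  apply: norm_monotone => i; rewrite coord_truncate coordZ coord_ones.
  by case: ifP => _; rewrite ?mulr1 ?absc // rnorm0 rnorm_ge0.
by rewrite rnormZ absc mulrC ler_wpM2r // ltW.
Qed.

(** If the triangle inequality is an equality for a sum of unit vectors, then
the span carries the [ell1] norm: with coefficients in [0, 1],
[‖sum c_i e_i‖ >= ‖sum e_i‖ - ‖sum (1 - c_i) e_i‖ >= sum c_i]. *)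
Lemma sum_le_norm n (P : pred nat) z :
  \sum_(i < n | P i) 1 <= rnorm (\sum_(i < n | P i) e i) ->
  \sum_(i < n | P i) abs (j z i) <= rnorm z.
Proof.
move=> Pn.
suff ball z1 : rnorm z1 <= 1 -> \sum_(i < n | P i) abs (j z1 i) <= rnorm z1.
  have [->|z0] := eqVneq z 0.
    by rewrite rnorm0 big1 // => i _; rewrite coord0 rnorm0.
  have [z1 z11 ez] := normalize z0; rewrite ez rnormZ abs_normr.
  under eq_bigr do rewrite coordZ absM abs_normr.
  by rewrite -mulr_sumr ler_wpM2l ?rnorm_ge0 // ball ?z11.
move=> z1_le1.
pose a i : K := if P i then `|j z1 i| else 0.
pose y : X := \sum_(i < n) a i *: e i.
have yz : rnorm y <= rnorm z1.
  apply: norm_monotone => i; rewrite coord_sum /a.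
  by do 2?case: ifP => _; rewrite ?abs_normr // rnorm0 rnorm_ge0.
have le1 i : abs (j z1 i) <= 1 by rewrite (le_trans (j_coord _ _)).
have : rnorm (\sum_(i < n | P i) e i - y) <= \sum_(i < n | P i) (1 - abs (j z1 i)).
  rewrite /y [\sum_(i < n) _]big_mkcond /=.
  have -> : \sum_(i < n) a i *: e i = \sum_(i < n | P i) `|j z1 i| *: e i.
    rewrite [RHS]big_mkcond /=; apply: eq_bigr => i _.
    by rewrite /a; case: ifP; rewrite ?scale0r.
  rewrite -sumrB (le_trans (rnorm_sum _ _ _)) //; apply: ler_sum => i _.
  rewrite -{1}[e i]scale1r -scalerBl rnormZ e_norm mulr1 /rnorm ger0_norm.
    by rewrite reD reN re1.
  rewrite subr_ge0; move: (le1 i); rewrite /rnorm -[X in _ <= X](re1 R k) re_le //.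
have := rnormD (\sum_(i < n | P i) e i - y) y.
rewrite subrK sumrB; lra.
Qed.

Lemma ones_sum_le_norm n z : rnorm (ones n) = n%:R ->
  \sum_(i < n) abs (j z i) <= rnorm z.
Proof.
move=> onesn; apply: (@sum_le_norm n predT).
by rewrite -/(ones n) onesn sumr_const card_ord.
Qed.

Lemma ones_sum_le_norm' n (i : 'I_n.+1) z : rnorm (ones n) = n%:R ->
  \sum_(l < n.+1 | (l : nat) != i) abs (j z l) <= rnorm z.
Proof.
move=> onesn; apply: (@sum_le_norm n.+1 (fun l => l != i :> nat)).
have -> : \sum_(l < n.+1 | (l : nat) != i) e l = ones n.+1 - e i.
  by rewrite /ones [in RHS](bigD1 i) //= [RHS]addrC addKr.
rewrite ones_drop ?onesn; last by rewrite -ltnS.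
have : \sum_(l < n.+1) (1 : R) = n.+1%:R by rewrite sumr_const card_ord.
by rewrite (bigD1 i) //= -natr1; lra.
Qed.

(** * No stall at a finite value above 1 *)

(** The functional [phi] that almost norms [x] is almost the sum of the first
[q = n.+2] coordinates.  The test functional is [z |-> phi z - 2 z_0 phi(e_0) + z_q] up to
sign; it would be bounded by about 1 on the slice, but takes a value of modulus
about [q + 1] at [y], a vector of norm at most [q]. *)
Lemma no_intermediate n : rnorm (ones n.+2) = n.+2%:R ->
  ~ (forall m, rnorm (ones m) <= n.+2%:R).
Proof.
set q := n.+2 => onesq ones_leq.
have q2 : 2 <= q%:R :> R by rewrite ler_nat.
pose x := ones q; pose y := ones q.+1 - e 0 - e 0.
have x_neq0 : x != 0.
  by apply/eqP => x0; move: onesq; rewrite -/x x0 rnorm0; lra.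
have y_neq0 : y != 0.
  apply/eqP => y0; have : j y q = 0 by rewrite y0 coord0.
  rewrite !coordB coord_ones !j_basis ltnSn !subr0 => /eqP.
  by rewrite oner_eq0.
have y_le : rnorm y <= q%:R.
  rewrite -[q%:R]mulr1; apply: norm_le_sup => // i.
  rewrite !coordB coord_ones !j_basis.
  case: eqVneq => [->|_]; first by rewrite subrr sub0r rnormN abs1.
  by rewrite !subr0; case: ltnP; rewrite ?abs1 ?rnorm0.
(* eps is so small that delta q + (q^2 + 5 q) eps, the total error, is below 1;
   delta is the square root of the error 2 eps in almost_aligned *)
pose delta : R := (4 * q%:R)^-1.
have q4 : 0 < 4 * q%:R :> R by lra.
have deltaq : delta * q%:R = 4^-1 by rewrite /delta; field; lra.
have delta0 : 0 < delta by rewrite invr_gt0.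
pose eps := delta ^+ 2 / 2.
have eps0 : 0 < eps by rewrite divr_gt0 // exprn_gt0.
have epsE : eps * q%:R ^+ 2 = 32^-1.
  have -> : eps * q%:R ^+ 2 = (delta * q%:R) ^+ 2 / 2 by rewrite /eps; ring.
  by rewrite deltaq; field.
have epsq : eps * q%:R <= 64^-1 by nra.
have [phi [phi1 phix phiy]] := lush_test X_lush x_neq0 y_neq0 eps0.
rewrite -/x onesq in phix.
(* x + w still has norm at most q when w lives off the first q coordinates *)
have off w : (forall i, (i < q)%N -> j w i = 0) -> (forall i, abs (j w i) <= 1) ->
    abs (phi w) <= eps * q%:R.
  move=> w0 w1.
  have : abs (phi x) + abs (phi w) <= q%:R.
    apply: functional_add_le => // t t' t1 t'1.
    rewrite -[q%:R]mulr1; apply: norm_le_sup => // i.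
    rewrite coordD !coordZ coord_ones; case: ltnP => iq.
      by rewrite w0 // mulr0 addr0 mulr1 abs_unimodular.
    by rewrite mulr0 add0r absM abs_unimodular // mul1r.
  by have := re_le_abs (phi x); lra.
set f := phi (e 0).
pose h z := (j z 0 * f *+ 1 - (phi z - j z 0 * f)) - j z q.
have hB z : abs (h z) <= 2 * rnorm z.
  rewrite (le_trans (rnormB _ _)) // mulr2n mulrDl !mul1r lerD //.
  by rewrite (le_trans (rnormB _ _)) // mulr1n split_coord.
have h_lin a v w : h (a *: v + w) = a * h v + h w.
  have phi_lin : phi (a *: v + w) = a * phi v + phi w by rewrite linearP.
  rewrite /h !coordD !coordZ phi_lin.
  rewrite (@test_linear K a (j v 0) (j w 0) (phi v) (phi w) f 1).
  by rewrite [a * (_ - j v q)]mulrBr [- (_ + j w q)]opprD addrACA.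
have hy : q%:R + 1 - 2 * (eps * q%:R) <= abs (h y).
  have -> : h y = - (phi x + phi (e q) + 1).
    have jy0 : j y 0 = -1 by rewrite !coordB coord_ones !j_basis subrr sub0r.
    have jyq : j y q = 1 by rewrite !coordB coord_ones !j_basis ltnSn !subr0.
    have phiyE : phi y = phi x + phi (e q) - f - f.
      by rewrite /y onesS !linearB linearD.
    rewrite /h jy0 jyq phiyE mulr1n mulN1r opprK subrK -opprD -!opprD.
    by rewrite [f + _]addrC subrK.
  rewrite rnormN; apply: le_trans (re_le_abs _); rewrite !reD re1.
  have : abs (phi (e q)) <= eps * q%:R.
    apply: off => i; rewrite j_basis; last by case: eqVneq; rewrite ?abs1 ?rnorm0.
    by move=> iq; rewrite ltn_eqF.
  have := re_le_abs (- phi (e q)); rewrite reN rnormN.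
  by lra.
have := phiy h (1 + delta + (q%:R + 1) * eps) 2 h_lin hB.
set c := _ + _ * eps => hphi.
suff hy_upper : abs (h y) <= (c + 2 * eps) * rnorm y.
  have : (c + 2 * eps) * rnorm y <= (c + 2 * eps) * q%:R.
    have qeps : 0 <= q%:R * eps by apply: mulr_ge0; lra.
    by rewrite ler_wpM2l // /c mulrDl; lra.
  have -> : (c + 2 * eps) * q%:R =
      q%:R + delta * q%:R + eps * q%:R ^+ 2 + 3 * (eps * q%:R) by rewrite /c; ring.
  by rewrite deltaq epsE; lra.
apply: hphi => z z1 phiz.
set u := j z 0 * f; set w := phi z - u.
have uw : abs u + abs w <= 1 by apply: le_trans z1; exact: split_coord.
have uwE : u + w = phi z by rewrite /w [u + _]addrC subrK.
have phiz_abs := lt_le_trans phiz (re_le_abs _).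
have uw1 : 1 - eps <= abs (u + w) by rewrite uwE ltW.
have align := almost_aligned 1 (ltW eps0) uw uw1.
have z_coord i : abs (j z i) <= 1 by rewrite (le_trans (j_coord _ _)).
have phi_e i : abs (phi (e i)) <= 1 by rewrite -(e_norm i).
have uz0 : abs u <= abs (j z 0).
  by rewrite absM ler_piMr ?rnorm_ge0 //; exact: phi_e.
pose S := \sum_(i < n.+1) abs (j z i.+1).
(* the q coordinates other than 0, and those other than 1, have sum at most 1 *)
have sum0 : S + abs (j z q) <= 1.
  apply: le_trans z1; have := ones_sum_le_norm' (ord0 : 'I_q.+1) z onesq.
  by rewrite big_mkcond big_ord_recl /= add0r big_ord_recr /=.
have sum1 : abs (j z 0) + abs (j z q) <= 1.
  apply: le_trans z1.
  have := ones_sum_le_norm' (Ordinal (isT : (1 < q.+1)%N)) z onesq.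
  rewrite big_mkcond big_ord_recl /= big_ord_recl /= add0r big_ord_recr /=.
  apply: le_trans; rewrite lerD2l lerDr; apply: sumr_ge0 => i _.
  exact: rnorm_ge0.
have head : 1 - eps < abs u + S + eps * q%:R.
  apply: lt_le_trans phiz_abs _.
  have -> : phi z = phi (truncate q z) + phi (z - truncate q z).
    by rewrite -linearD addrC subrK.
  rewrite (le_trans (@rnormD _ _ K^o _ _)) // lerD //.
    rewrite /truncate linear_sum big_ord_recl linearZ /=.
    rewrite (le_trans (@rnormD _ _ K^o _ _)) // lerD2l.
    rewrite (le_trans (rnorm_sum _ _ _)) //; apply: ler_sum => i _.
    rewrite linearZ /= absM ler_piMr ?rnorm_ge0 //.
  apply: off => i; rewrite coordB coord_truncate; first by move=> ->; rewrite subrr.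
  by case: ifP; rewrite ?subrr ?rnorm0 // subr0.
rewrite /h -/u -/w; apply: le_trans (rnormB _ _) _.
have := le_trans uw1 (@rnormD _ _ K^o u w).
have := rnorm_ge0 (u *+ 1 - w : K^o).
have := rnorm_ge0 (j z q : K^o).
have := rnorm_ge0 (u : K^o); have := rnorm_ge0 (w : K^o).
move: align uw uz0 sum0 sum1 head; rewrite /c mulr1 mul1r.
move: (abs (u *+ 1 - w)) (abs u) (abs w) (abs (j z 0)) (abs (j z q)) => D A B Z0 Z.
move=> align AB AZ sum0 sum1 head B0 A0 Zge D0 ABge.
have deltaE : delta ^+ 2 = 2 * eps by rewrite /eps; field.
have eps_q : 0 <= q%:R * eps by apply: mulr_ge0; lra.
have [AleB|BltA] := leP A B.
  have : D ^+ 2 <= (B - A + delta) ^+ 2.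
    have : 0 <= (B - A) * delta by apply: mulr_ge0; lra.
    by nra.
  by rewrite ler_sqr ?nnegrE; lra.
have : D ^+ 2 <= (A - B + delta) ^+ 2.
  have : 0 <= (A - B) * delta by apply: mulr_ge0; lra.
  by nra.
by rewrite ler_sqr ?nnegrE; lra.
Qed.

(** * Identification with the classical spaces *)

Lemma cvg0_rnorm (f : nat -> K^o) :
  f @ \oo --> (0 : K^o) <->
  forall d : R, 0 < d -> exists N, forall n, (N <= n)%N -> abs (f n) < d.
Proof.
split=> [f0 d d0|f0].
  have [N _ fN] := f0 _ (@nbhs_rnorm R k K^o 0 d d0).
  by exists N => n /fN; rewrite /= sub0r rnormN.
apply/cvg_ballP => d d0; have d0' : 0 < re d by rewrite -(re0 R k) re_lt // ltW.
have [N fN] := f0 _ d0'; exists N => // n /= nN.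
by apply/(@rnorm_ball R k K^o _ _ _ _ d0 erefl); rewrite sub0r rnormN fN.
Qed.

Lemma identify_c0 : (forall n, rnorm (ones n) <= 1) ->
  (forall x, ellinf (j x) /\ ellinf_norm (j x) <= rnorm x) ->
  is_seq_space j (@c0 R k) (@ellinf_norm R k).
Proof.
move=> ones1 j_ellinf; split; last first.
  move=> x; have [ubx normx] := j_ellinf x.
  apply/eqP; rewrite eq_le normx andbT; apply/ler_addgt0Pr => d d0.
  have coord_le i : abs (j x i) <= ellinf_norm (j x) by apply: ub_le_sup => //; exists i.
  have sup0 := le_trans (rnorm_ge0 _) (coord_le 0).
  rewrite -[leRHS]mul1r; apply: norm_le_sup => // [|i]; first by lra.
  by rewrite (le_trans (coord_le i)) // lerDl ltW.
apply/seteqP; split => [_ [x _ <-]|f /cvg0_rnorm f0].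
  apply/cvg0_rnorm => d d0; have [N xN] := truncate_cvg x d0.
  exists N => n /xN; apply: le_lt_trans.
  by have := j_coord (x - truncate n x) n; rewrite coordB coord_truncate ltnn subr0.
pose s n : X := \sum_(i < n) f i *: e i.
have [y sy] : exists y, forall d : R, 0 < d ->
    exists N, forall n, (N <= n)%N -> rnorm (y - s n) < d.
  apply: complete_rnorm => d d0; have d20 : 0 < d / 2 by lra.
  have [N fN] := f0 _ d20; exists N => n nN.
  have : rnorm (s n - s N) <= 1 * (d / 2).
    apply: norm_le_sup => // i; rewrite coordB !coord_sum.
    have [iN|Ni] := ltnP i N.
      by rewrite (leq_trans iN nN) subrr rnorm0 ltW.
    by case: ifP => _; rewrite subr0 ?rnorm0 ltW // fN.
  by lra.
exists y => //; apply/funext => i; apply/eqP; rewrite -subr_eq0; apply/eqP.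
apply: rnorm_eq0; apply/eqP; rewrite eq_le rnorm_ge0 andbT; apply/ler_addgt0Pr => d d0.
have [N yN] := sy d d0; have := ltW (yN (maxn N i.+1) (leq_maxl _ _)).
rewrite add0r; apply: le_trans; have := j_coord (y - s (maxn N i.+1)) i.
by rewrite coordB coord_sum leq_maxr.
Qed.

Lemma identify_ell1 : (forall n, rnorm (ones n) = n%:R) ->
  (forall f : nat -> K^o, ell1 f -> exists2 x : X, j x = f & rnorm x <= ell1_norm f) ->
  is_seq_space j (@ell1 R k) (@ell1_norm R k).
Proof.
move=> onesn ell1_j.
have partial x n : series (fun i => abs (j x i)) n <= rnorm x.
  by rewrite /series /= big_mkord; exact: ones_sum_le_norm.
have j_ell1 x : ell1 (j x).
  apply: nondecreasing_is_cvgn; last by exists (rnorm x) => _ [n _ <-].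
  apply/nondecreasing_seqP => n; rewrite /series /= big_nat_recr //= lerDl.
  exact: rnorm_ge0.
split; last first.
  move=> x; apply/eqP; rewrite eq_le; apply/andP; split.
    by have [x' /j_inj ->] := ell1_j _ (j_ell1 x).
  by apply: limr_le; [exact: j_ell1 | near=> n; exact: partial].
apply/seteqP; split => [_ [x _ <-] //|f /ell1_j[x <- _]].
by exists x.
Unshelve. all: by end_near. Qed.

Lemma lush_identification :
  (forall x, ellinf (j x) /\ ellinf_norm (j x) <= rnorm x) ->
  (forall f : nat -> K^o, ell1 f -> exists2 x : X, j x = f & rnorm x <= ell1_norm f) ->
  is_seq_space j (@c0 R k) (@ellinf_norm R k) \/
  is_seq_space j (@ell1 R k) (@ell1_norm R k).
Proof.
move=> j_ellinf ell1_j.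
have [onesn|[m [m0 onesm ones_lem]]] := ones_dichotomy.
  by right; exact: identify_ell1.
left; apply: identify_c0 => //.
case: m m0 onesm ones_lem => [//|[//|m]] _ onesm ones_lem.
by case: (no_intermediate onesm).
Qed.

End Kothe.

Section RearrangementInvariant.
Variables (R : realType) (k : scalar_kind).
Local Notation K := (scalar_field R k).
Local Notation abs z := (rnorm (z : K^o)).

Lemma finite_support_series (f : nat -> K^o) N : (forall n, (N <= n)%N -> f n = 0) ->
  series (fun n => rnorm (f n)) @ \oo --> \sum_(n < N) rnorm (f n).
Proof.
move=> f0; apply: cvg_near_cst; near=> n.
have nN : (N <= n)%N by near: n; exact: nbhs_infty_ge.
rewrite /series /= -(big_mkord predT (fun i => rnorm (f i))) (@big_cat_nat _ _ _ N) //=.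
have -> : \sum_(N <= i < n) rnorm (f i) = 0.
  by rewrite big_nat_cond big1 // => i /andP[/andP[Ni _] _]; rewrite f0 // rnorm0.
by rewrite addr0.
Unshelve. all: by end_near. Qed.

Lemma finite_support_ell1 (f : nat -> K^o) N : (forall n, (N <= n)%N -> f n = 0) -> ell1 f.
Proof. by move=> /finite_support_series f_cvg; apply/cvg_ex; eexists; exact: f_cvg. Qed.

Definition swap i n l : nat := if l == i then n else if l == n then i else l.

Lemma swapK i n : cancel (swap i n) (swap i n).
Proof.
move=> l; rewrite /swap; have [->|li] := eqVneq l i; first by case: eqVneq; rewrite ?eqxx.
by have [->|ln] := eqVneq l n; rewrite ?eqxx // (negbTE li) (negbTE ln).
Qed.

End RearrangementInvariant.

Theorem theorem3p3 (R : realType) (k : scalar_kind)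
    (X : completeNormedModType (scalar_field R k))
    (j : {linear X -> (nat -> (scalar_field R k)^o)})
    (X_sep : separable_space X) (X_ri : rearrangement_invariant j)
    (X_lush : lush X) :
  is_seq_space j (@c0 R k) (@ellinf_norm R k) \/
  is_seq_space j (@ell1 R k) (@ell1_norm R k).
Proof.
have [[j_inj j_ideal j_indic] j_rearr _ _ ell1_j j_ellinf] := X_ri.
have /choice[e j_e] : forall i, exists x, j x = \1_[set i] :> (nat -> (scalar_field R k)^o).
  by move=> i; have [x _ jx] := j_indic [set i] (finite_set1 i); exists x.
have j_basis i n : j (e i) n = (n == i)%:R.
  have ni : (n \in [set i]) = (n == i) by apply/idP/eqP; rewrite inE.
  by rewrite j_e indicE ni.
have j_coord x n : rnorm (j x n : (scalar_field R k)^o) <= rnorm x.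
  have [ubx] := j_ellinf x; apply: le_trans.
  by apply: ub_le_sup => //; exists n.
have e_off i n : (i.+1 <= n)%N -> j (e i) n = 0.
  by move=> ni; rewrite j_basis gtn_eqF.
have e_norm i : rnorm (e i) = 1.
  apply/eqP; rewrite eq_le; apply/andP; split; last first.
    by apply: le_trans (j_coord (e i) i); rewrite j_basis eqxx abs1.
  have [x /j_inj -> xn] := ell1_j _ (finite_support_ell1 (e_off i)).
  apply: le_trans xn _; rewrite /ell1_norm (cvg_lim _ (finite_support_series (e_off i))) //.
  rewrite big_ord_recr /= j_basis eqxx abs1 big1 ?add0r // => l _.
  by rewrite j_basis ltn_eqF // rnorm0.
have ones_drop i n : (i <= n)%N -> rnorm (ones e n.+1 - e i) = rnorm (ones e n).
  move=> iln.
  have ones_off m : (n <= m)%N -> j (ones e n) m = 0.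
    by move=> nm; rewrite (coord_ones j_basis) ltnNge nm.
  have [_ rearr] := j_rearr _ _ (@swapK i n) (@swapK i n) _ (finite_support_ell1 ones_off).
  apply/esym/rearr => //; apply/funext => m.
  rewrite coordB (coord_ones j_basis) j_basis /= (coord_ones j_basis) /swap.
  have [->|mi] := eqVneq m i; first by rewrite ltnn ltnS iln subrr.
  have [mn|mn] := eqVneq m n; last by rewrite subr0 ltnS leq_eqVlt (negbTE mn).
  by rewrite mn ltnSn subr0 ltn_neqAle iln andbT eq_sym -mn mi.
exact: (lush_identification j_inj j_ideal j_basis j_coord X_sep e_norm X_lush ones_drop).
Qed.
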